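(* Let $n_0\ge 0$ be an integer and let $\mathbf{x}$ be a sequence over a finite alphabet with no palindromic factor of length $\geq n_0$. Then $r_{\mathbf{x}}(n) \leq r_{\mathbf{x}}(n+1)$ for all $n \geq n_0$. Furthermore, if $r_{\mathbf{x}}(n+2) = r_{\mathbf{x}}(n)$ for some $n \geq n_0$, then $\mathbf{x}$ is eventually periodic.
   Context: A factor of a sequence is a finite contiguous block. For $u=u(1)\cdots u(m)$, $u^R=u(m)\cdots u(1)$; a palindrome satisfies $u=u^R$. $r_{\mathbf{x}}(n)$ is the number of distinct length-$n$ factors of $\mathbf{x}$ up to $u\sim v\iff v\in\{u,u^R\}$. $\mathbf{x}$ is eventually periodic if $\mathbf{x}=uv^\omega$ with $v$ nonempty. *)

(* Defs.v *)
From mathcomp Require Import all_boot.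
From mathcomp Require Import boolp.

Set Implicit Arguments.
Unset Strict Implicit.
Unset Printing Implicit Defensive.

Section Words.
Variable A : finType.
Implicit Types (x : nat -> A) (u v : seq A).

Definition is_factor x u : Prop :=
  exists i, u = mkseq (fun j => x (i + j)) (size u).

Definition palindrome u : bool := u == rev u.

Definition rev_equiv : rel (seq A) := fun u v => v \in [:: u; rev u].

Lemma rev_equivP : equivalence_rel rev_equiv.
Proof.
move=> u v w; rewrite /rev_equiv !inE; split; first by rewrite eqxx.
by case/orP=> /eqP->; rewrite ?revK // orbC.
Qed.

(* Being a factor is not decidable; [asbool] turns it into a boolean. *)
Definition factors x n : {set n.-tuple A} :=
  [set u : n.-tuple A | `[< is_factor x u >]].

Definition reflection_complexity x n : nat :=
  #|equivalence_partition (fun u v : n.-tuple A => rev_equiv u v)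
                          (factors x n)|.

(* The sequence u v^omega for the nonempty word v = a :: v'; a is also the
   (irrelevant) default of nth. *)
Definition cat_omega u (a : A) (v' : seq A) : nat -> A := fun i =>
  if i < size u then nth a u i
  else nth a (a :: v') ((i - size u) %% size (a :: v')).

Definition eventually_periodic x : Prop :=
  exists u a v', x =1 cat_omega u a v'.

End Words.

(* Main.v *)
Require Import Defs.
From mathcomp Require Import all_boot.
From mathcomp Require Import boolp.
From mathcomp Require Import zify.

(** Let G_n be the set of factors of length n together with their reversals.
    If no factor of length n is a palindrome, reversal acts freely on G_n, so
    |G_n| = 2 r(n) is even.  Deleting the last letter maps G_{n+1} to G_n, and
    its image contains all of G_n except possibly the reversal of the prefix p
    of x; hence |G_n| <= |G_{n+1}| + 1, and parity gives r(n) <= r(n+1).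

    If r(n+1) <= r(n), argue by induction on |G_n|.  Either p or its reversal
    occurs again in the shift of x; then the deletion map is onto, hence
    bijective, so every window of length n determines the next letter and x is
    eventually periodic.  Or passing to the shift removes exactly two elements
    from G_n and at least two from G_{n+1}, and the inequality persists. *)

Set Implicit Arguments.
Unset Strict Implicit.
Unset Printing Implicit Defensive.

Section ReflectionComplexity.
Variable A : finType.
Implicit Types (x : nat -> A) (i j k m n p : nat).

(** * Factors as fixed-length windows *)

Definition window x n i : n.-tuple A := mktuple (fun j : 'I_n => x (i + j)).

Lemma windowE x n i : window x n i = mkseq (fun j => x (i + j)) n :> seq A.
Proof.
apply: (@eq_from_nth _ (x 0)); rewrite ?size_tuple ?size_mkseq // => k kn.
by rewrite nth_mkseq // -[k]/(val (Ordinal kn)) -tnth_nth tnth_mktuple.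
Qed.

Lemma window_consE x n i : window x n.+1 i = x i :: window x n i.+1 :> seq A.
Proof.
rewrite !windowE /mkseq /= -[1]addn0 iotaDl -map_comp addn0; congr cons.
by apply: eq_map => j /=; rewrite addnA addn1.
Qed.

Lemma window_rconsE x n i :
  window x n.+1 i = rcons (window x n i) (x (i + n)) :> seq A.
Proof. by rewrite !windowE /mkseq -addn1 iotaD map_cat cats1. Qed.

Lemma factorsP x n (u : n.-tuple A) :
  reflect (exists i, u = window x n i) (u \in factors x n).
Proof.
rewrite inE; apply: (iffP (asboolP _)) => -[i Eu]; exists i.
  by apply: val_inj; rewrite /= [LHS]Eu windowE size_tuple.
by rewrite size_tuple -windowE Eu.
Qed.

Lemma window_factor x n i : window x n i \in factors x n.
Proof. by apply/factorsP; exists i. Qed.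

(** * Reversal classes and the parity count *)

Definition rev_tup n (u : n.-tuple A) : n.-tuple A := [tuple of rev u].

Lemma rev_tupK n : involutive (@rev_tup n).
Proof. by move=> u; apply: val_inj; rewrite /= revK. Qed.

Lemma rev_equivE n (u v : n.-tuple A) :
  rev_equiv u v = (v \in [set u; rev_tup u]).
Proof. by rewrite /rev_equiv !inE. Qed.

Lemma palindromeE n (u : n.-tuple A) : palindrome u = (u == rev_tup u).
Proof. by []. Qed.

Definition sym_factors x n : {set n.-tuple A} :=
  [set u | (u \in factors x n) || (rev_tup u \in factors x n)].

Lemma sym_factors_rev x n (u : n.-tuple A) :
  (rev_tup u \in sym_factors x n) = (u \in sym_factors x n).
Proof. by rewrite !inE rev_tupK orbC. Qed.

Lemma window_sym_factor x n i : window x n i \in sym_factors x n.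
Proof. by rewrite inE window_factor. Qed.

Definition rev_class n (u : n.-tuple A) : {set n.-tuple A} := [set u; rev_tup u].

Lemma rev_class_rev n (u : n.-tuple A) : rev_class (rev_tup u) = rev_class u.
Proof. by rewrite /rev_class rev_tupK setUC. Qed.

Lemma rev_class_eq n (u v : n.-tuple A) :
  v \in rev_class u -> rev_class v = rev_class u.
Proof. by rewrite !inE => /orP[]/eqP->; rewrite ?rev_class_rev. Qed.

(** Replaces classes cut down to [factors x n], which may miss a reversal, by full pairs of a word
    and its reversal. *)
Lemma reflection_complexityE x n :
  reflection_complexity x n = #|@rev_class n @: sym_factors x n|.
Proof.
have -> : @rev_class n @: sym_factors x n = @rev_class n @: factors x n.
  apply/setP=> B; apply/imsetP/imsetP => -[u]; last first.
    by move=> uF ->; exists u => //; rewrite inE uF.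
  rewrite inE => /orP[] uF ->; first by exists u.
  by exists (rev_tup u); rewrite ?rev_class_rev.
have restr (u : n.-tuple A) : [set v in factors x n | rev_equiv u v] =
               factors x n :&: rev_class u.
  by apply/setP=> v; rewrite in_setI in_set rev_equivE.
rewrite /reflection_complexity /equivalence_partition.
under eq_imset => u do rewrite restr.
rewrite (imset_comp (fun B => factors x n :&: B) (@rev_class n)).
(* The trace of a class on the factors determines it: the trace contains the factor [u], and any
   member of a class generates it. *)
apply: card_in_imset => _ _ /imsetP[u uF ->] /imsetP[v vF ->] /setP/(_ u).
by rewrite !in_setI uF set21 => /esym; apply: rev_class_eq.
Qed.

Definition palindrome_free x n := forall i, ~~ palindrome (window x n i).

Lemma palindrome_free_shift x n :
  palindrome_free x n -> palindrome_free (fun i => x i.+1) n.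
Proof. by move=> pf i; apply: (pf i.+1). Qed.

Lemma sym_factors_nonpal x n (u : n.-tuple A) :
  palindrome_free x n -> u \in sym_factors x n -> u != rev_tup u.
Proof.
move=> pf; rewrite inE => /orP[] /factorsP[i Eu].
  by rewrite Eu; apply: pf.
by have := pf i; rewrite -Eu palindromeE rev_tupK eq_sym.
Qed.

Lemma card_sym_factors x n : palindrome_free x n ->
  #|sym_factors x n| = (reflection_complexity x n).*2.
Proof.
move=> pf; rewrite reflection_complexityE -muln2.
have eqR : {in sym_factors x n & &,
    equivalence_rel (fun u v : n.-tuple A => rev_equiv u v)}.
  by move=> u v w _ _ _; apply: rev_equivP.
(* Closure under reversal makes each class lie entirely inside [sym_factors x n]. *)
have EP : equivalence_partition (fun u v : n.-tuple A => rev_equiv u v)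
            (sym_factors x n) = @rev_class n @: sym_factors x n.
  apply: eq_in_imset => u uG; apply/setP=> v.
  rewrite in_set rev_equivE; apply: andb_idl.
  by case/set2P=> ->; rewrite ?sym_factors_rev.
apply: card_uniform_partition; last first.
  by rewrite -EP; apply: equivalence_partitionP.
by move=> _ /imsetP[u uG ->]; rewrite cards2 (sym_factors_nonpal pf uG).
Qed.

(** * Deleting the last letter, and monotonicity *)

Definition delete_last n (w : n.+1.-tuple A) : n.-tuple A :=
  [tuple of rev (behead (rev w))].

Lemma delete_last_window x n i : delete_last (window x n.+1 i) = window x n i.
Proof. by apply: val_inj; rewrite /= window_rconsE rev_rcons /= revK. Qed.

Lemma delete_last_rev_window x n i :
  delete_last (rev_tup (window x n.+1 i)) = rev_tup (window x n i.+1).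
Proof. by apply: val_inj; rewrite /= revK window_consE. Qed.

Lemma sym_factorsP x n (u : n.-tuple A) : u \in sym_factors x n ->
  exists i, u = window x n i \/ u = rev_tup (window x n i).
Proof.
rewrite inE => /orP[] /factorsP[i Eu]; exists i; first by left.
by right; rewrite -Eu rev_tupK.
Qed.

(** A window extends by the letter after it, a reversed window by the letter before it. Only
    position 0 has no preceding letter. *)
Lemma mem_delete_last x n (u : n.-tuple A) : u \in sym_factors x n ->
  u != rev_tup (window x n 0) ->
  u \in @delete_last n @: sym_factors x n.+1.
Proof.
move=> /sym_factorsP[[|i] [] ->]; rewrite ?eqxx // => _;
  try (by rewrite -delete_last_window; apply/imset_f/window_sym_factor).
rewrite -delete_last_rev_window; apply: imset_f.
by rewrite sym_factors_rev window_sym_factor.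
Qed.

Lemma reflection_complexity_leS x n :
  palindrome_free x n -> palindrome_free x n.+1 ->
  reflection_complexity x n <= reflection_complexity x n.+1.
Proof.
move=> pf pfS.
have : sym_factors x n \subset
    rev_tup (window x n 0) |: @delete_last n @: sym_factors x n.+1.
  apply/subsetP=> u uG; rewrite in_setU1.
  by case: eqVneq => //= une; apply: mem_delete_last.
move/subset_leq_card; rewrite cardsU1.
have := leq_imset_card (@delete_last n) (sym_factors x n.+1).
rewrite !card_sym_factors //; move: #|_ @: _| => c.
(* Both cardinals are doubles, so an excess of at most one is no excess. *)
by case: (_ \notin _) => /=; lia.
Qed.

(** * Ultimate periodicity from determinism *)

Definition ultimately_periodic x :=
  exists p N, 0 < p /\ forall m, N <= m -> x (m + p) = x m.

Lemma ultimately_periodicW x : ultimately_periodic x -> eventually_periodic x.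
Proof.
move=> [[|p] [N [// _ xP]]].
(* The period word is [x N] followed by the next [p] letters; its length is [p.+1]. *)
exists (mkseq x N), (x N), (mkseq (fun k => x (N.+1 + k)) p) => m.
have xPk k r : x (N + r + k * p.+1) = x (N + r).
  elim: k => [|k IHk]; first by rewrite addn0.
  by rewrite mulSn addnCA addnC xP ?IHk // -addnA leq_addr.
rewrite /cat_omega size_mkseq /= size_mkseq.
case: ltnP => [mN|Nm]; first by rewrite nth_mkseq.
have -> : x m = x (N + (m - N) %% p.+1).
  by rewrite -(xPk ((m - N) %/ p.+1)) -addnA [_ %% _ + _]addnC -divn_eq subnKC.
have := ltn_pmod (m - N) (ltn0Sn p).
case: (_ %% _) => [|r] /= rp; first by rewrite addn0.
by rewrite nth_mkseq // addSnnS.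
Qed.

Lemma ultimately_periodic_shift x :
  ultimately_periodic (fun i => x i.+1) -> ultimately_periodic x.
Proof.
move=> [p [N [p0 xP]]]; exists p, N.+1; split=> // -[//|m] Nm.
exact: xP.
Qed.

(** By pigeonhole two windows coincide; determinism propagates the equality to all later positions,
    so their distance is a period. *)
Lemma deterministic_ultimately_periodic x n :
  (forall i j, window x n i = window x n j -> x (i + n) = x (j + n)) ->
  ultimately_periodic x.
Proof.
move=> det.
have [i [j [ij Eij]]] : exists i j, i < j /\ window x n i = window x n j.
  pose f (i : 'I_#|{: n.-tuple A}|.+1) := window x n i.
  have /injectivePn[i [j ne Eij]] : ~~ injectiveb f.
    by apply/injectiveP => /leq_card; rewrite card_ord ltnn.
  case: (ltngtP i j) => [lt|lt|/val_inj E]; last by rewrite E eqxx in ne.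
    by exists i, j.
  by exists j, i.
have Ek k : window x n (i + k) = window x n (j + k).
  elim: k => [|k IHk]; first by rewrite !addn0.
  have : window x n.+1 (i + k) = window x n.+1 (j + k) :> seq A.
    by rewrite !window_rconsE IHk (det _ _ IHk).
  rewrite !window_consE !addnS => /(congr1 behead) E.
  by apply: val_inj; apply: E.
exists (j - i), (i + n); split=> [|m le_m]; first by rewrite subn_gt0.
have -> : m = i + (m - (i + n)) + n by lia.
by rewrite (det _ _ (Ek _)); congr x; lia.
Qed.

(** * Passing to the shift *)

Lemma sym_factors_shift x n :
  sym_factors x n =
  rev_class (window x n 0) :|: sym_factors (fun i => x i.+1) n.
Proof.
apply/setP=> u; rewrite in_setU; apply/idP/orP.
  case/sym_factorsP=> -[|i] [] ->; rewrite ?sym_factors_rev.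
  - by left; rewrite set21.
  - by left; rewrite set22.
  - by right; apply: (window_sym_factor (fun i => x i.+1)).
  - by right; apply: (window_sym_factor (fun i => x i.+1)).
case=> [/set2P[]->|]; rewrite ?sym_factors_rev ?window_sym_factor //.
case/sym_factorsP=> i [] ->; rewrite ?sym_factors_rev;
  exact: (window_sym_factor x n i.+1).
Qed.

Lemma card_sym_factors_shift x n :
  palindrome_free x n ->
  #|sym_factors x n| = (window x n 0 \notin sym_factors (fun i => x i.+1) n).*2
                       + #|sym_factors (fun i => x i.+1) n|.
Proof.
move=> pf; rewrite sym_factors_shift /rev_class -setUA cardsU1 cardsU1.
rewrite in_setU1 negb_or sym_factors_rev.
have -> /= := sym_factors_nonpal pf (window_sym_factor x n 0).
by rewrite addnA addnn.
Qed.

Lemma stationary_ultimately_periodic x n :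
  palindrome_free x n -> palindrome_free x n.+1 ->
  reflection_complexity x n.+1 <= reflection_complexity x n ->
  ultimately_periodic x.
Proof.
move=> pf pfS; rewrite -leq_double -!card_sym_factors //.
(* Strong induction on the cardinal, with [x] generalized so that the hypothesis applies to its
   shift. *)
have [k] := ubnP #|sym_factors x n|; elim: k => // k IHk in x pf pfS *.
move=> ltk le_card; pose y i := x i.+1.
have cardE := card_sym_factors_shift pf; have cardSE := card_sym_factors_shift pfS.
have [p_in|p_notin] := boolP (window x n 0 \in sym_factors y n).
  have onto : sym_factors x n \subset @delete_last n @: sym_factors x n.+1.
    apply/subsetP=> u uG.
    have [->|une] := eqVneq u (rev_tup (window x n 0)); last first.
      exact: mem_delete_last.
    (* The recurrence lies at position [i.+1] of [x], so the reversed prefix now has an extension: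
       by [x i] if the prefix itself recurs, by the following letter if its reversal does. *)
    case: (sym_factorsP p_in) => i [] ->; rewrite ?rev_tupK.
      rewrite -[window y n i]/(window x n i.+1) -delete_last_rev_window.
      by apply: imset_f; rewrite sym_factors_rev window_sym_factor.
    rewrite -[window y n i]/(window x n i.+1) -delete_last_window.
    exact/imset_f/window_sym_factor.
  have /imset_injP inj : #|@delete_last n @: sym_factors x n.+1| ==
                         #|sym_factors x n.+1|.
    rewrite eqn_leq leq_imset_card /=.
    (* A surjection onto a set at least as large is injective. *)
    exact: leq_trans le_card (subset_leq_card onto).
  apply: (@deterministic_ultimately_periodic x n) => i j Eij.
  have /(congr1 val) : window x n.+1 i = window x n.+1 j.
    by apply: inj; rewrite ?window_sym_factor // !delete_last_window.
  by rewrite /= !window_rconsE => /rcons_inj[].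
(* A recurrence of the longer prefix, direct or reversed, would contain one of the shorter
   prefix. *)
have pS_notin : window x n.+1 0 \notin sym_factors y n.+1.
  apply: contra p_notin => /sym_factorsP[i [] Ei].
    rewrite -delete_last_window Ei delete_last_window.
    exact: window_sym_factor.
  rewrite -delete_last_window Ei delete_last_rev_window sym_factors_rev.
  exact: window_sym_factor.
apply: ultimately_periodic_shift; apply: IHk.
- exact: palindrome_free_shift.
- exact: palindrome_free_shift.
- by move: cardE; rewrite p_notin; lia.
(* Both cardinals drop by exactly two, which preserves the inequality. *)
- by move: cardE cardSE; rewrite p_notin pS_notin; lia.
Qed.

End ReflectionComplexity.

Theorem theorem3p19 (A : finType) (x : nat -> A) (n0 : nat)
    (no_pal : forall u : seq A,
       is_factor x u -> n0 <= size u -> ~ palindrome u) :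
  (forall n : nat, n0 <= n ->
     reflection_complexity x n <= reflection_complexity x n.+1) /\
  ((exists n : nat, n0 <= n /\
     reflection_complexity x n.+2 = reflection_complexity x n) ->
   eventually_periodic x).
Proof.
have pf n : n0 <= n -> palindrome_free x n.
  move=> n0n i; apply/negP; apply: no_pal; last by rewrite size_tuple.
  by exists i; rewrite size_tuple windowE.
have mono n : n0 <= n ->
    reflection_complexity x n <= reflection_complexity x n.+1.
  by move=> n0n; apply: reflection_complexity_leS; apply: pf; lia.
split=> // -[n [n0n E]]; apply: ultimately_periodicW.
apply: (@stationary_ultimately_periodic _ x n); [apply: pf | apply: pf |]; try lia.
(* Monotonicity at [n.+1] bounds the middle value by the value at [n.+2], which equals that at
   [n]. *)
by rewrite -E mono //; lia.
Qed.
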